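(* Under the standing assumptions, for all $z\in\mathbb C$: $\widehat U_2^{(0)}(z)=d^{(0)}(z)\,d^{(2)}(z)$ and $\widetilde U_2^{(1)}(z)=d^{(1)}(z)$; $\widehat U_2^{(2j)}(z)=\widehat U_2^{(2j-2)}(z)\,d^{(2j+2)}(z)$ for $1\le j\le n-1$; $\widetilde U_2^{(2j+1)}(z)=\widetilde U_2^{(2j-1)}(z)\,d^{(2j+1)}(z)$ for $1\le j\le n$. Consequently $\widehat U_2^{(2j)}=d^{(0)}d^{(2)}\cdots d^{(2j+2)}$ for $0\le j\le n-1$ and $\widetilde U_2^{(2j+1)}=d^{(1)}d^{(3)}\cdots d^{(2j+1)}$ for $0\le j\le n$.
   Context: Let $q,n\in\mathbb N$ and let $a<b$ be real numbers. All matrices are complex; $I_q$, $0_q$ are the $q\times q$ identity and zero matrices; for a matrix-valued function $F$, $F^*(\bar z)$ means $(F(\bar z))^*$. Let $s_0,\dots,s_{2n+1}$ be Hermitian $q\times q$ matrices and set $\widehat s_j:=-ab\,s_j+(a+b)s_{j+1}-s_{j+2}$. Define $H_{2,j}:=(\widehat s_{l+k})_{l,k=0}^{j}$ and $K_{1,j}:=(bs_{l+k}-s_{l+k+1})_{l,k=0}^{j}$. Standing assumption: $H_{2,n-1}$ and $K_{1,n}$ are positive definite. Let $T_0:=0_q$ and, for $j\ge1$, let $T_j$ be the $(j+1)\times(j+1)$ block matrix (blocks $q\times q$) with $I_q$ in block positions $(l+1,l)$, $l=0,\dots,j-1$, and $0_q$ elsewhere; $R_j(z):=(I_{(j+1)q}-zT_j)^{-1}$;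 $v_j:=\mathrm{col}(I_q,0_q,\dots,0_q)\in\mathbb C^{(j+1)q\times q}$. Let $u_{2,0}:=-(a+b)s_0+s_1$, $u_{2,j}:=\mathrm{col}(u_{2,0},-\widehat s_0,\dots,-\widehat s_{j-1})$, $\widetilde u_{1,j}:=\mathrm{col}(s_0,s_1-bs_0,\dots,s_j-bs_{j-1})$; for $j\ge1$, $Y_{2,j}:=\mathrm{col}(\widehat s_j,\dots,\widehat s_{2j-1})$, $\widetilde Y_{1,j}:=\mathrm{col}(bs_j-s_{j+1},\dots,bs_{2j-1}-s_{2j})$. Schur complements: $\widehat H_{2,0}:=\widehat s_0$, $\widehat H_{2,j}:=\widehat s_{2j}-Y_{2,j}^*H_{2,j-1}^{-1}Y_{2,j}$; $\widehat K_{1,0}:=bs_0-s_1$, $\widehat K_{1,j}:=bs_{2j}-s_{2j+1}-\widetilde Y_{1,j}^*K_{1,j-1}^{-1}\widetilde Y_{1,j}$ ($j\ge1$). Polynomials: $P_{2,0}:=I_q$, $Q_{2,0}(z):=-(u_{2,0}+zs_0)$, $\Gamma_{1,0}:=I_q$, $\Theta_{1,0}:=s_0$; for $j\ge1$: $P_{2,j}(z):=(-Y_{2,j}^*H_{2,j-1}^{-1},I_q)R_j(z)v_j$, $Q_{2,j}(z):=-(-Y_{2,j}^*H_{2,j-1}^{-1},I_q)R_j(z)(u_{2,j}+zv_js_0)$, $\Gamma_{1,j}(z):=(-\widetilde Y_{1,j}^*K_{1,j-1}^{-1},I_q)R_j(z)v_j$, $\Theta_{1,j}(z):=(-\widetilde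 Y_{1,j}^*K_{1,j-1}^{-1},I_q)R_j(z)\widetilde u_{1,j}$. Auxiliary matrices: for $0\le j\le n-1$, $\widehat U_2^{(2j)}(z)=\begin{pmatrix}\widehat\alpha&\widehat\beta\\ \widehat\gamma&\widehat\delta\end{pmatrix}$ with $\widehat\alpha=I_q-(z-a)(u_{2,j}^*+zs_0v_j^* )R_j^*(\bar z)H_{2,j}^{-1}R_j(a)v_j$, $\widehat\beta=(z-a)\big(s_0+(u_{2,j}^*+zs_0v_j^* )R_j^*(\bar z)H_{2,j}^{-1}R_j(a)(u_{2,j}+av_js_0)\big)$, $\widehat\gamma=-(z-a)v_j^*R_j^*(\bar z)H_{2,j}^{-1}R_j(a)v_j$, $\widehat\delta=I_q+(z-a)v_j^*R_j^*(\bar z)H_{2,j}^{-1}R_j(a)(u_{2,j}+av_js_0)$. For $0\le j\le n$, $\widetilde U_2^{(2j+1)}(z)=\begin{pmatrix}I_q-(z-a)\widetilde u_{1,j}^*R_j^*(\bar z)K_{1,j}^{-1}R_j(a)v_j & (z-a)\widetilde u_{1,j}^*R_j^*(\bar z)K_{1,j}^{-1}R_j(a)\widetilde u_{1,j}\\ -(z-a)v_j^*R_j^*(\bar z)K_{1,j}^{-1}R_j(a)v_j & I_q+(z-a)v_j^*R_j^*(\bar z)K_{1,j}^{-1}R_j(a)\widetilde u_{1,j}\end{pmatrix}$. Blaschke–Potapov factors: $d^{(0)}(z):=\begin{pmatrix}I_q&(z-a)s_0\\0_q&I_q\end{pmatrix}$; for $0\le j\le n-1$, $d^{(2j+2)}(z):=\begin{pmatrix}I_q+(z-a)Q_{2,j}^*(a)\widehat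 H_{2,j}^{-1}P_{2,j}(a) & (z-a)Q_{2,j}^*(a)\widehat H_{2,j}^{-1}Q_{2,j}(a)\\ -(z-a)P_{2,j}^*(a)\widehat H_{2,j}^{-1}P_{2,j}(a) & I_q-(z-a)P_{2,j}^*(a)\widehat H_{2,j}^{-1}Q_{2,j}(a)\end{pmatrix}$; for $0\le j\le n$, $d^{(2j+1)}(z):=\begin{pmatrix}I_q-(z-a)\Theta_{1,j}^*(a)\widehat K_{1,j}^{-1}\Gamma_{1,j}(a) & (z-a)\Theta_{1,j}^*(a)\widehat K_{1,j}^{-1}\Theta_{1,j}(a)\\ -(z-a)\Gamma_{1,j}^*(a)\widehat K_{1,j}^{-1}\Gamma_{1,j}(a) & I_q+(z-a)\Gamma_{1,j}^*(a)\widehat K_{1,j}^{-1}\Theta_{1,j}(a)\end{pmatrix}$. *)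

(* Defs.v *)
(* Complex matrices are modelled over an arbitrary
   numClosedFieldType C (with complex conjugation), e.g. algC; the statement is
   purely algebraic in z. *)
From HB Require Import structures.
From mathcomp Require Import all_boot all_order all_algebra.
Set Implicit Arguments. Unset Strict Implicit. Unset Printing Implicit Defensive.
Import Order.TTheory GRing.Theory Num.Theory.
Local Open Scope ring_scope.

Section Defs.
Variable C : numClosedFieldType.

(* conjugate transpose *)
Definition adjmx (m k : nat) (A : 'M[C]_(m, k)) : 'M[C]_(k, m) :=
  (map_mx Num.conj A)^T.

Definition is_hermitian (m : nat) (A : 'M[C]_m) : Prop := adjmx A = A.

(* positive definite: x^* A x > 0 for every nonzero x *)
Definition is_posdef (m : nat) (A : 'M[C]_m) : Prop :=
  forall x : 'cV[C]_m, x != 0 -> 0 < (adjmx x *m A *m x) 0 0.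

Variable q : nat.

(* entry (r,c) of a q x q matrix, for natural indices r,c < q *)
Definition ent (A : 'M[C]_q) (r c : nat) : C :=
  match insub r, insub c with
  | Some r', Some c' => A r' c'
  | _, _ => 0
  end.

(* block matrices with m x m blocks (resp. m blocks) of size q x q;
   block (l,k) is F l k, with l,k < m. *)
Definition blockmx (m : nat) (F : nat -> nat -> 'M[C]_q) : 'M[C]_(m * q) :=
  \matrix_(i, k) ent (F (i %/ q)%N (k %/ q)%N) (i %% q)%N (k %% q)%N.
Definition bcol (m : nat) (F : nat -> 'M[C]_q) : 'M[C]_(m * q, q) :=
  \matrix_(i, k) ent (F (i %/ q)%N) (i %% q)%N k.

(* the block row (W, I_q) *)
Definition hrow (m : nat) (W : 'M[C]_(q, m * q)) : 'M[C]_(q, m.+1 * q) :=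
  castmx (erefl q, esym (mulSnr m q)) (row_mx W 1%:M).

Variables (a b : C) (s : nat -> 'M[C]_q).

Definition shat (j : nat) : 'M[C]_q :=
  - (a * b) *: s j + (a + b) *: s j.+1 - s j.+2.

(* H_{2,j} and K_{1,j} *)
Definition H2 (j : nat) : 'M[C]_(j.+1 * q) := blockmx j.+1 (fun l k => shat (l + k)).
Definition K1 (j : nat) : 'M[C]_(j.+1 * q) :=
  blockmx j.+1 (fun l k => b *: s (l + k) - s (l + k).+1).

Definition Tm (j : nat) : 'M[C]_(j.+1 * q) :=
  blockmx j.+1 (fun l k => if l == k.+1 then 1%:M else 0).
Definition Rm (j : nat) (z : C) : 'M[C]_(j.+1 * q) := invmx (1%:M - z *: Tm j).
Definition vv (j : nat) : 'M[C]_(j.+1 * q, q) :=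
  bcol j.+1 (fun l => if l == 0%N then 1%:M else 0).

Definition u20 : 'M[C]_q := - (a + b) *: s 0 + s 1.
Definition u2 (j : nat) : 'M[C]_(j.+1 * q, q) :=
  bcol j.+1 (fun l => if l == 0%N then u20 else - shat l.-1).
Definition ut1 (j : nat) : 'M[C]_(j.+1 * q, q) :=
  bcol j.+1 (fun l => if l == 0%N then s 0 else s l - b *: s l.-1).
(* Y_{2,j}, Ytilde_{1,j} for j >= 1 (j blocks) *)
Definition Y2 (j : nat) : 'M[C]_(j * q, q) := bcol j (fun l => shat (j + l)).
Definition Yt1 (j : nat) : 'M[C]_(j * q, q) :=
  bcol j (fun l => b *: s (j + l) - s (j + l).+1).

(* Schur complements *)
Definition H2hat (j : nat) : 'M[C]_q :=
  match j with
  | 0 => shat 0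
  | j'.+1 => shat (2 * j'.+1) - adjmx (Y2 j'.+1) *m invmx (H2 j') *m Y2 j'.+1
  end.
Definition K1hat (j : nat) : 'M[C]_q :=
  match j with
  | 0 => b *: s 0 - s 1
  | j'.+1 => b *: s (2 * j'.+1) - s (2 * j'.+1).+1
             - adjmx (Yt1 j'.+1) *m invmx (K1 j') *m Yt1 j'.+1
  end.

(* polynomials *)
Definition P2 (j : nat) (z : C) : 'M[C]_q :=
  match j with
  | 0 => 1%:M
  | j'.+1 => hrow (- adjmx (Y2 j'.+1) *m invmx (H2 j')) *m Rm j'.+1 z *m vv j'.+1
  end.
Definition Q2 (j : nat) (z : C) : 'M[C]_q :=
  match j with
  | 0 => - (u20 + z *: s 0)
  | j'.+1 => - (hrow (- adjmx (Y2 j'.+1) *m invmx (H2 j')) *m Rm j'.+1 z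
                 *m (u2 j'.+1 + z *: (vv j'.+1 *m s 0)))
  end.
Definition Gam1 (j : nat) (z : C) : 'M[C]_q :=
  match j with
  | 0 => 1%:M
  | j'.+1 => hrow (- adjmx (Yt1 j'.+1) *m invmx (K1 j')) *m Rm j'.+1 z *m vv j'.+1
  end.
Definition Theta1 (j : nat) (z : C) : 'M[C]_q :=
  match j with
  | 0 => s 0
  | j'.+1 => hrow (- adjmx (Yt1 j'.+1) *m invmx (K1 j')) *m Rm j'.+1 z *m ut1 j'.+1
  end.

(* auxiliary matrices  \widehat U_2^{(2j)}(z)  and  \widetilde U_2^{(2j+1)}(z) *)
Definition Uhat (j : nat) (z : C) : 'M[C]_(q + q) :=
  let Rs := adjmx (Rm j z^*) in
  let M := invmx (H2 j) *m Rm j a in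
  let w := u2 j + a *: (vv j *m s 0) in
  block_mx
    (1%:M - (z - a) *: ((adjmx (u2 j) + z *: (s 0 *m adjmx (vv j))) *m Rs *m M *m vv j))
    ((z - a) *: (s 0 + (adjmx (u2 j) + z *: (s 0 *m adjmx (vv j))) *m Rs *m M *m w))
    (- (z - a) *: (adjmx (vv j) *m Rs *m M *m vv j))
    (1%:M + (z - a) *: (adjmx (vv j) *m Rs *m M *m w)).

Definition Utilde (j : nat) (z : C) : 'M[C]_(q + q) :=
  let Rs := adjmx (Rm j z^*) in
  let M := invmx (K1 j) *m Rm j a in
  block_mx
    (1%:M - (z - a) *: (adjmx (ut1 j) *m Rs *m M *m vv j))
    ((z - a) *: (adjmx (ut1 j) *m Rs *m M *m ut1 j))
    (- (z - a) *: (adjmx (vv j) *m Rs *m M *m vv j))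
    (1%:M + (z - a) *: (adjmx (vv j) *m Rs *m M *m ut1 j)).

(* Blaschke--Potapov factors *)
Definition d0 (z : C) : 'M[C]_(q + q) :=
  block_mx 1%:M ((z - a) *: s 0) 0 1%:M.

(* d^{(2j+2)} *)
Definition dev (j : nat) (z : C) : 'M[C]_(q + q) :=
  let Hi := invmx (H2hat j) in
  block_mx
    (1%:M + (z - a) *: (adjmx (Q2 j a) *m Hi *m P2 j a))
    ((z - a) *: (adjmx (Q2 j a) *m Hi *m Q2 j a))
    (- (z - a) *: (adjmx (P2 j a) *m Hi *m P2 j a))
    (1%:M - (z - a) *: (adjmx (P2 j a) *m Hi *m Q2 j a)).

(* d^{(2j+1)} *)
Definition dodd (j : nat) (z : C) : 'M[C]_(q + q) :=
  let Ki := invmx (K1hat j) in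
  block_mx
    (1%:M - (z - a) *: (adjmx (Theta1 j a) *m Ki *m Gam1 j a))
    ((z - a) *: (adjmx (Theta1 j a) *m Ki *m Theta1 j a))
    (- (z - a) *: (adjmx (Gam1 j a) *m Ki *m Gam1 j a))
    (1%:M + (z - a) *: (adjmx (Gam1 j a) *m Ki *m Theta1 j a)).

(* d^{(2i)} for i >= 0 *)
Definition deven (i : nat) (z : C) : 'M[C]_(q + q) :=
  match i with 0 => d0 z | j.+1 => dev j z end.

End Defs.

(* ordered product M_0 M_1 ... M_k of a list of square matrices *)
Definition mxprod (R : pzRingType) (m : nat) (l : seq 'M[R]_m) : 'M[R]_m :=
  foldr (fun M acc => M *m acc) 1%:M l.

(* Main.v *)
Require Import Defs.
From HB Require Import structures.
From mathcomp Require Import all_boot all_order all_algebra.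
Import Order.TTheory GRing.Theory Num.Theory.
Local Open Scope ring_scope.

(** Apart from [d0], every factor has, up to the shear below, the form
    [1 + (z - a) (u, v)^H L (-v, u)].  Passing from a block Hankel matrix [K] to
    the next larger one, the block inversion formula splits off from
    [K^-1] a term [h^H kap^-1 h], with [kap] the Schur complement and [h] the row
    defining the orthogonal polynomials.  That this additive term is
    multiplicative, i.e. produces a right factor, amounts to
    [U(z) (u, v)^H R(a)^H h^H = (u, v)^H R(conj z)^H h^H] for the smaller matrix
    [U], which follows from the resolvent identity and the Lyapunov equation
    [K T^H - T K = u v^H - v u^H].  Both families are instances:
    the odd one directly, the even one after conjugation by the shear
    [(1, z s_0; 0, 1)], which absorbs the terms in [s_0] of [\hat U_2] and [Q_2]. *)

Local Notation "A ^H" := (adjmx A) (at level 2, format "A ^H").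

(** * Conjugate transposition and positive definiteness *)

Section Adjoint.
Variable C : numClosedFieldType.

Lemma adjmxK m k (A : 'M[C]_(m, k)) : A^H^H = A.
Proof. by apply/matrixP=> i j; rewrite !mxE conjCK. Qed.

Lemma adjmxM m k p (A : 'M[C]_(m, k)) (B : 'M_(k, p)) : (A *m B)^H = B^H *m A^H.
Proof. by rewrite /adjmx map_mxM trmx_mul. Qed.

Lemma adjmxD m k (A B : 'M[C]_(m, k)) : (A + B)^H = A^H + B^H.
Proof. by rewrite /adjmx map_mxD linearD. Qed.

Lemma adjmxN m k (A : 'M[C]_(m, k)) : (- A)^H = - A^H.
Proof. by rewrite /adjmx map_mxN linearN. Qed.

Lemma adjmxB m k (A B : 'M[C]_(m, k)) : (A - B)^H = A^H - B^H.
Proof. by rewrite adjmxD adjmxN. Qed.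

Lemma adjmxZ m k z (A : 'M[C]_(m, k)) : (z *: A)^H = z^* *: A^H.
Proof. by rewrite /adjmx map_mxZ linearZ. Qed.

Lemma adjmx0 m k : (0 : 'M[C]_(m, k))^H = 0.
Proof. by rewrite /adjmx map_mx0 trmx0. Qed.

Lemma adjmx1 m : (1%:M : 'M[C]_m)^H = 1%:M.
Proof. by rewrite /adjmx map_mx1 trmx1. Qed.

Lemma adjmxV m (A : 'M[C]_m) : (invmx A)^H = invmx A^H.
Proof. by rewrite /adjmx map_invmx trmx_inv. Qed.

(** A nonzero vector in the kernel of [A] would make the quadratic form vanish. *)
Lemma posdef_unitmx m (A : 'M[C]_m) : is_posdef A -> A \in unitmx.
Proof.
move=> posA; rewrite -unitmx_tr -row_free_unit -kermx_eq0.
apply/rowV0P => v /sub_kermxP /(congr1 trmx); rewrite trmx_mul trmxK trmx0 => Av0.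
apply/eqP; apply: contraTT isT => v0.
have := posA v^T; rewrite -mulmxA Av0 mulmx0 mxE ltxx; apply.
by rewrite -trmx0 (inj_eq trmx_inj).
Qed.

(** The left inverse [D] makes [B] injective, so a nonzero [x] has a nonzero image [B *m x]. *)
Lemma posdef_congr m k (A : 'M[C]_m) (B : 'M_(m, k)) (D : 'M_(k, m)) :
  D *m B = 1%:M -> is_posdef A -> is_posdef (B^H *m A *m B).
Proof.
move=> DB posA x x0.
have -> : x^H *m (B^H *m A *m B) *m x = (B *m x)^H *m A *m (B *m x).
  by rewrite adjmxM !mulmxA.
apply: posA; apply: contraNneq x0 => Bx0.
by rewrite -[x]mul1mx -DB -mulmxA Bx0 mulmx0.
Qed.

End Adjoint.

(** * Block inversion through a Schur complement *)

Section Schur.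
Variables (C : numClosedFieldType) (m k q : nat).

(** [E] and [e] embed two complementary coordinate spaces isometrically, in place of a literal
    partition into blocks with its casts. The vector [h^H = e - E K'^-1 Y] is block elimination: [K]
    sends it to [e kap], so multiplying the claimed inverse by [K] collapses it to
    [E E^H + e e^H]. *)
Lemma schur_invmx (K : 'M[C]_m) (E : 'M_(m, k)) (e : 'M_(m, q)) :
    let K' := E^H *m K *m E in
    let Y := E^H *m K *m e in
    let h := - Y^H *m invmx K' *m E^H + e^H in
    let kap := e^H *m K *m e - Y^H *m invmx K' *m Y in
    K^H = K -> K' \in unitmx -> is_posdef K ->
    e^H *m E = 0 -> e^H *m e = 1%:M -> E *m E^H + e *m e^H = 1%:M ->
  E^H *m K *m h^H = 0 /\ invmx K = E *m invmx K' *m E^H + h^H *m invmx kap *m h.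
Proof.
move=> K' Y h kap KH uK' posK eE ee EEee.
have K'H : K'^H = K' by rewrite /K' !adjmxM adjmxK KH mulmxA.
have YH : Y^H = e^H *m K *m E by rewrite /Y !adjmxM adjmxK KH mulmxA.
have [K'E YE] : E^H *m K *m E = K' /\ E^H *m K *m e = Y by [].
rewrite {}/kap {}/h; clearbody K' Y.
set h := _ + e^H; set kap := _ - _.
have hH : h^H = e - E *m (invmx K' *m Y).
  by rewrite adjmxD !adjmxM adjmxN !adjmxK adjmxV K'H !mulmxN addrC.
have Kh : E^H *m K *m h^H = 0.
  by rewrite hH mulmxBr mulmxA K'E mulKVmx // YE subrr.
have eKh : e^H *m K *m h^H = kap.
  by rewrite hH mulmxBr [_ *m (E *m _)]mulmxA -YH mulmxA.
have KhE : K *m h^H = e *m kap.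
  rewrite -[LHS]mul1mx -EEee mulmxDl -!mulmxA !(mulmxA _ K) Kh eKh.
  by rewrite mulmx0 add0r.
have he : e^H *m h^H = 1%:M by rewrite hH mulmxBr mulmxA eE mul0mx subr0.
(* [kap] is a congruence of [K] along [h^H], which is injective by [he]; hence it is positive
   definite and invertible. *)
have hKh : h *m K *m h^H = kap.
  by rewrite -mulmxA KhE mulmxA -[h *m e]adjmxK adjmxM he adjmx1 mul1mx.
have ukap : kap \in unitmx.
  apply: posdef_unitmx; rewrite -hKh -{1}[h]adjmxK.
  exact: (posdef_congr _ _ _ _ _ _ he posK).
split=> //; have uK := posdef_unitmx _ _ _ posK.
apply: (can_inj (mulKmx uK)); rewrite mulmxV // mulmxDr !mulmxA KhE mulmxK //.
have -> : K *m E = E *m K' + e *m Y^H.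
  by rewrite -[LHS]mul1mx -EEee mulmxDl YH -K'E !mulmxA.
rewrite !mulmxDl mulmxK // [in e *m h]mulmxDr !mulNmx mulmxN !mulmxA.
by rewrite -addrA addNKr EEee.
Qed.

End Schur.

(** * Elementary factors, shears and the multiplicative splitting *)

Section Potapov.
Variables (C : numClosedFieldType) (q : nat).

(** The row [(-v, u)] is [(u, v) J] with [J = (0, I; -I, 0)], so this is the Blaschke-Potapov form
    [1 + c G^H L G J] for [G = (u, v)]. *)
Definition potapov m (u v : 'M[C]_(m, q)) (L : 'M_m) (c : C) : 'M_(q + q) :=
  1%:M + c *: (col_mx u^H v^H *m L *m row_mx (- v) u).

Lemma potapovE m (u v : 'M[C]_(m, q)) L c :
  potapov m u v L c =
  block_mx (1%:M - c *: (u^H *m L *m v)) (c *: (u^H *m L *m u))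
    (- c *: (v^H *m L *m v)) (1%:M + c *: (v^H *m L *m u)).
Proof.
rewrite /potapov mul_col_mx mul_col_row !mulmxN scale_block_mx.
by rewrite scalar_mx_block add_block_mx !scalerN scaleNr !add0r.
Qed.

Lemma potapov_mul m k (V : 'M_(m, k)) (u v : 'M[C]_(k, q)) L c :
  potapov m (V *m u) (V *m v) L c = potapov k u v (V^H *m L *m V) c.
Proof. by rewrite !potapovE !adjmxM !mulmxA. Qed.

Definition shear (S : 'M[C]_q) x : 'M_(q + q) := block_mx 1%:M (x *: S) 0 1%:M.

Lemma shearD S x y : shear S (x + y) = shear S x *m shear S y.
Proof.
rewrite /shear mulmx_block !mulmx1 !mul1mx !mulmx0 mul0mx !addr0 add0r.
by rewrite scalerDl [x *: S + _]addrC.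
Qed.

(** The two parameters differ because the auxiliary matrix carries [z] on the left and [a] on the
    right, while its factors carry [a] on both sides. The product of the shears alone leaves
    [(x - y) *: S], which vanishes in the latter case. *)
Lemma shear_potapov m (u v : 'M[C]_(m, q)) L c S x y :
  shear S x *m potapov m u v L c *m shear S (- y) =
  block_mx (1%:M - c *: ((u^H + x *: (S *m v^H)) *m L *m v))
    ((x - y) *: S + c *: ((u^H + x *: (S *m v^H)) *m L *m (u + y *: (v *m S))))
    (- c *: (v^H *m L *m v)) (1%:M + c *: (v^H *m L *m (u + y *: (v *m S)))).
Proof.
rewrite mulmxDr mulmx1 mulmxDl -shearD -scalemxAr -scalemxAl !mulmxA.
rewrite /shear mul_block_col !mul1mx mul0mx add0r -(mulmxA _ (row_mx _ _)).
rewrite mul_row_block !mulmx1 mulmx0 addr0.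
rewrite mul_col_mx mul_col_row !mulmxN scale_block_mx add_block_mx.
rewrite !scalerN add0r !scaleNr !mulNmx !mulmxN opprK -scalemxAr -scalemxAl.
by rewrite [_ + u]addrC.
Qed.

(* [E] embeds the smaller space, [F] is its shifted embedding, so that
   [T = F E^H] and the compression [E^H F] is the smaller shift. *)
Lemma potapov_step m k (E F : 'M[C]_(m, k)) (T K : 'M_m) (u v : 'M_(m, q))
    (h : 'M_(q, m)) (kap : 'M_q) (a z : C) :
    let K' := E^H *m K *m E in
    let T' := E^H *m F in
    let R x := invmx (1%:M - x *: T) in
    let R' x := invmx (1%:M - x *: T') in
    a^* = a -> T = F *m E^H ->
    (forall x, 1%:M - x *: T \in unitmx) ->
    (forall x, 1%:M - x *: T' \in unitmx) ->
    K' \in unitmx ->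
    invmx K = E *m invmx K' *m E^H + h^H *m invmx kap *m h ->
    E^H *m K *m h^H = 0 ->
    K *m T^H - T *m K = u *m v^H - v *m u^H ->
  potapov m u v ((R z^*)^H *m (invmx K *m R a)) (z - a) =
  potapov k (E^H *m u) (E^H *m v) ((R' z^*)^H *m (invmx K' *m R' a)) (z - a) *m
  potapov q (h *m R a *m u) (h *m R a *m v) (invmx kap) (z - a).
Proof.
move=> K' T' R R' aR TE uT uT' uK' invK Kh lyap.
(* Both sides of [E^H (1 - x T) = (1 - x T') E^H] equal [E^H - x E^H F E^H]. *)
have ER x : E^H *m R x = R' x *m E^H.
  apply: (can_inj (mulKmx (uT' x))); rewrite mulKVmx //.
  apply: (can_inj (mulmxK (uT x))); rewrite -!mulmxA mulVmx // mulmx1.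
  by rewrite mulmxBr mulmxBl mulmx1 mul1mx -scalemxAr -scalemxAl TE mulmxA.
(* The resolvent identity [R x - R a = (x - a) R a T R x], with [T] split as [F E^H] and [E^H] moved
   through [R x]. *)
have Rresolv x : R x - R a = (x - a) *: (R a *m F *m R' x *m E^H).
  rewrite -[_ *m R' x *m _]mulmxA -ER mulmxA -[R a *m F *m _]mulmxA -TE.
  apply: (can_inj (mulKmx (uT a))); apply: (can_inj (mulmxK (uT x))).
  rewrite (mulmxBr _ (R x)) mulmxV // (mulmxBl _ _ (1%:M - x *: T)) mul1mx.
  rewrite -(mulmxA _ (R x)) mulVmx // mulmx1 -scalemxAr -scalemxAl !mulmxA.
  rewrite mulmxV // mul1mx -(mulmxA _ (R x)) mulVmx // mulmx1.
  by rewrite opprB addrC addrA subrK -scalerBl.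
set S := (R z^*)^H; set S' := (R' z^*)^H.
set col := col_mx u^H v^H; set row := row_mx (- v) u.
set g := (R a)^H *m h^H.
have SE : S *m E = E *m S'.
  by apply: (can_inj (@adjmxK _ _ _)); rewrite !adjmxM !adjmxK ER.
have SB : S - (R a)^H = (z - a) *: (E *m S' *m F^H *m (R a)^H).
  apply: (can_inj (@adjmxK _ _ _)).
  by rewrite adjmxZ !adjmxM adjmxB !adjmxK rmorphB /= aR Rresolv !mulmxA.
(* Writing [g] as a fixed point isolates [h^H], which [E^H K] annihilates; the remaining
   [T^H = E F^H] produces [K']. *)
have gE : g = h^H + a *: (T^H *m g).
  have : (1%:M - a *: T)^H *m g = h^H.
    by rewrite mulmxA -adjmxM mulVmx // adjmx1 mul1mx.
  by rewrite adjmxB adjmxZ adjmx1 aR mulmxBl mul1mx -scalemxAl => <-; rewrite subrK.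
have Kg : E^H *m K *m g = a *: (K' *m F^H *m g).
  rewrite {1}gE mulmxDr Kh add0r -scalemxAr TE adjmxM adjmxK.
  by rewrite /K' !mulmxA.
(* Since [row *m col = u v^H - v u^H], the Lyapunov equation applies. The factor [(1 - a T') K']
   obtained here is exactly the inverse of [K'^-1 R' a]. *)
have rowcolE : E^H *m row *m col *m g = (1%:M - a *: T') *m K' *m F^H *m g.
  rewrite -[_ *m row *m col]mulmxA mul_row_col mulNmx addrC -lyap.
  have -> : E^H *m (K *m T^H - T *m K) *m g =
      E^H *m K *m (T^H *m g) - T' *m (E^H *m K *m g).
    by rewrite mulmxBr mulmxBl [in E^H *m (T *m K)]TE /T' !mulmxA.
  by rewrite Kg TE adjmxM adjmxK -scalemxAr !mulmxBl mul1mx -!scalemxAl /K' !mulmxA.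
clearbody K'.
(* The smaller matrix carries [col *m g] to [col *m S *m h^H]: after the cancellation prepared by
   [rowcolE], what remains is the adjoint resolvent identity [SB] applied to [h^H]. *)
have key : col *m S *m h^H = (1%:M + (z - a) *:
    (col *m E *m S' *m invmx K' *m R' a *m E^H *m row)) *m col *m g.
  rewrite !mulmxDl mul1mx -!scalemxAl.
  rewrite -[_ *m row *m col]mulmxA -[_ *m E^H *m _]mulmxA -[_ *m (E^H *m _) *m g]mulmxA.
  rewrite [E^H *m (row *m col)]mulmxA rowcolE !mulmxA -[_ *m R' a *m _]mulmxA mulVmx //.
  rewrite mulmx1 -[_ *m invmx K' *m _]mulmxA mulVmx // mulmx1.
  by rewrite -(subrK (R a)^H S) SB mulmxDr mulmxDl addrC -scalemxAr -scalemxAl !mulmxA.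
have colE : col_mx (E^H *m u)^H (E^H *m v)^H = col *m E.
  by rewrite !adjmxM !adjmxK mul_col_mx.
have rowE : row_mx (- (E^H *m v)) (E^H *m u) = E^H *m row.
  by rewrite mul_mx_row mulmxN.
have colh : col_mx (h *m R a *m u)^H (h *m R a *m v)^H = col *m g.
  by rewrite !adjmxM mul_col_mx.
have rowh : row_mx (- (h *m R a *m v)) (h *m R a *m u) = h *m R a *m row.
  by rewrite mul_mx_row mulmxN.
rewrite /potapov colE rowE colh rowh -/col -/row -/S -/S' mulmxDr mulmx1 -addrA.
congr (_ + _).
rewrite !mulmxA -scalemxAr !mulmxA in key *.
rewrite -key -scalerDr; congr (_ *: _).
(* The first summand of [invK] gives the smaller matrix by intertwining; the second is the term
   already rewritten by [key]. *)
rewrite invK !(mulmxDr, mulmxDl) !mulmxA; congr (_ + _).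
by rewrite -(mulmxA col S E) SE -(mulmxA _ (E^H) (R a)) ER !mulmxA.
Qed.

End Potapov.

(** * Calculus of block matrices and block columns *)

Section Blocks.
Variables (C : numClosedFieldType) (q : nat).
Implicit Types (m p r : nat) (A B : 'M[C]_q).

Lemma entE A (i k : 'I_q) : ent A i k = A i k.
Proof. by rewrite /ent !valK. Qed.

Lemma mx_entP A B :
  (forall i k, (i < q)%N -> (k < q)%N -> ent A i k = ent B i k) -> A = B.
Proof. by move=> AB; apply/matrixP => i k; rewrite -!entE AB. Qed.

Lemma ent_mul A B i k : (i < q)%N -> (k < q)%N ->
  ent (A *m B) i k = \sum_(j < q) ent A i j * ent B j k.
Proof.
move=> iq kq; rewrite (entE _ (Ordinal iq) (Ordinal kq)) mxE.
by apply: eq_bigr => j _; rewrite -!entE.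
Qed.

Lemma ent_sum p (F : 'I_p -> 'M[C]_q) i k : (i < q)%N -> (k < q)%N ->
  ent (\sum_(t < p) F t) i k = \sum_(t < p) ent (F t) i k.
Proof.
move=> iq kq; rewrite (entE _ (Ordinal iq) (Ordinal kq)) summxE.
by apply: eq_bigr => j _; rewrite -entE.
Qed.

Lemma ent_adj A i k : (i < q)%N -> (k < q)%N -> ent A^H i k = (ent A k i)^*.
Proof.
move=> iq kq.
by rewrite (entE _ (Ordinal iq) (Ordinal kq)) !mxE -entE.
Qed.

(** Induction on [p] peels off the last [q] indices, on which the quotient by [q] is constant. *)
Lemma sum_blocks p (f : nat -> nat -> C) :
  \sum_(i < p * q) f (i %/ q)%N (i %% q)%N = \sum_(t < p) \sum_(j < q) f t j.
Proof.
elim: p => [|p IHp]; first by rewrite !big_ord0.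
rewrite big_ord_recr /= -IHp -!(big_mkord xpredT (fun i => f (i %/ q)%N (i %% q)%N)).
rewrite (big_cat_nat _ _ (n := p * q)) //=; last by rewrite leq_mul2r leqnSn orbT.
congr (_ + _); rewrite -{1}[(p * q)%N]add0n big_addn mulSn addnK big_mkord.
apply: eq_bigr => j _; have q0 : (0 < q)%N by apply: leq_ltn_trans (ltn_ord j).
by rewrite addnC divnMDl // divn_small // addn0 modnMDl modn_small.
Qed.

(** Division by [q = 0] causes no exception: the index type is then empty. *)
Lemma blk_div p (i : 'I_(p * q)) : (i %/ q < p)%N.
Proof.
by case: q i => [|q'] i; [case: i => i; rewrite muln0 | rewrite ltn_divLR].
Qed.

Lemma blk_mod p (i : 'I_(p * q)) : (i %% q < q)%N.
Proof. by case: q i => [|q'] i; [case: i => i; rewrite muln0 | rewrite ltn_mod]. Qed.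

Hint Resolve blk_div blk_mod : core.

(** The rectangular shape accommodates the embeddings of [m] blocks into [m.+1] blocks; the square
    case is [blockmx] by conversion. *)
Definition rblockmx m p (F : nat -> nat -> 'M[C]_q) : 'M[C]_(m * q, p * q) :=
  \matrix_(i, k) ent (F (i %/ q)%N (k %/ q)%N) (i %% q)%N (k %% q)%N.

Lemma blockmxE m F : blockmx m F = rblockmx m m F.
Proof. by []. Qed.

Lemma eq_rblockmx m p F G :
  (forall l k, (l < m)%N -> (k < p)%N -> F l k = G l k) ->
  rblockmx m p F = rblockmx m p G.
Proof. by move=> FG; apply/matrixP=> i k; rewrite !mxE FG. Qed.

Lemma eq_bcol m (F G : nat -> 'M[C]_q) :
  (forall l, (l < m)%N -> F l = G l) -> bcol m F = bcol m G.
Proof. by move=> FG; apply/matrixP=> i k; rewrite !mxE FG. Qed.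

Lemma mul_rblockmx m p r F G : rblockmx m p F *m rblockmx p r G =
  rblockmx m r (fun l k => \sum_(t < p) F l t *m G t k).
Proof.
apply/matrixP=> i k; rewrite !mxE ent_sum //.
under eq_bigr do rewrite !mxE.
rewrite (sum_blocks p (fun t j => ent (F (i %/ q)%N t) (i %% q)%N j *
  ent (G t (k %/ q)%N) j (k %% q)%N)).
by apply: eq_bigr => t _; rewrite ent_mul.
Qed.

Lemma mul_rblockmx_bcol m p F G : rblockmx m p F *m bcol p G =
  bcol m (fun l => \sum_(t < p) F l t *m G t).
Proof.
apply/matrixP=> i k; rewrite !mxE ent_sum //.
under eq_bigr do rewrite !mxE.
rewrite (sum_blocks p (fun t j => ent (F (i %/ q)%N t) (i %% q)%N j * ent (G t) j k)).
by apply: eq_bigr => t _; rewrite ent_mul.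
Qed.

Lemma mul_bcol_adj m p (F G : nat -> 'M[C]_q) : bcol m F *m (bcol p G)^H =
  rblockmx m p (fun l k => F l *m (G k)^H).
Proof.
apply/matrixP=> i k; rewrite !mxE ent_mul //.
by apply: eq_bigr => j _; rewrite !mxE ent_adj.
Qed.

Lemma mul_adj_bcol m (F G : nat -> 'M[C]_q) : (bcol m F)^H *m bcol m G =
  \sum_(t < m) (F t)^H *m G t.
Proof.
apply/mx_entP => i k iq kq; rewrite ent_sum //.
rewrite (entE _ (Ordinal iq) (Ordinal kq)) !mxE.
under eq_bigr do rewrite !mxE /=.
rewrite (sum_blocks m (fun t j => (ent (F t) j i)^* * ent (G t) j k)).
apply: eq_bigr => t _; rewrite ent_mul //.
by apply: eq_bigr => j _; rewrite ent_adj.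
Qed.

Lemma mul_bcol m F A : bcol m F *m A = bcol m (fun l => F l *m A).
Proof.
apply/matrixP=> i k; rewrite !mxE ent_mul //.
by apply: eq_bigr => j _; rewrite !mxE entE.
Qed.

Lemma adj_rblockmx m p F :
  (rblockmx m p F)^H = rblockmx p m (fun l k => (F k l)^H).
Proof. by apply/matrixP=> i k; rewrite !mxE ent_adj. Qed.

Lemma ent1 i k : (i < q)%N -> (k < q)%N -> ent (1%:M : 'M[C]_q) i k = (i == k)%:R.
Proof. by move=> iq kq; rewrite (entE _ (Ordinal iq) (Ordinal kq)) mxE. Qed.

Lemma ent0 i k : ent (0 : 'M[C]_q) i k = 0.
Proof. by rewrite /ent; case: insub => // i'; case: insub => // k'; rewrite mxE. Qed.

Lemma entB A B i k : ent (A - B) i k = ent A i k - ent B i k.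
Proof.
by rewrite /ent; case: insub => [i'|]; [case: insub => [k'|]|]; rewrite ?subr0 ?mxE.
Qed.

Lemma entD A B i k : ent (A + B) i k = ent A i k + ent B i k.
Proof.
by rewrite /ent; case: insub => [i'|]; [case: insub => [k'|]|]; rewrite ?addr0 ?mxE.
Qed.

Lemma rblockmxB m p F G :
  rblockmx m p F - rblockmx m p G = rblockmx m p (fun l k => F l k - G l k).
Proof. by apply/matrixP=> i k; rewrite !mxE entB. Qed.

Lemma rblockmxD m p F G :
  rblockmx m p F + rblockmx m p G = rblockmx m p (fun l k => F l k + G l k).
Proof. by apply/matrixP=> i k; rewrite !mxE entD. Qed.

Lemma eqn_blk i k : (i == k :> nat) = (i %/ q == k %/ q)%N && (i %% q == k %% q)%N.
Proof.
apply/eqP/andP => [->|[/eqP dik /eqP mik]]; first by rewrite !eqxx.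
by rewrite (divn_eq i q) dik mik -divn_eq.
Qed.

Lemma rblockmx1 m :
  rblockmx m m (fun l k => if l == k then 1%:M else 0) = 1%:M :> 'M[C]_(m * q).
Proof.
apply/matrixP=> i k; rewrite !mxE -val_eqE /= [in RHS]eqn_blk.
by case: (_ == _); rewrite ?ent1 ?ent0.
Qed.

Lemma sum_delta_mul p (G : nat -> 'M[C]_q) (l : nat) :
  \sum_(t < p) (if l == t :> nat then 1%:M else 0) *m G t = if (l < p)%N then G l else 0.
Proof.
rewrite -(@big_ord1_eq _ 0 +%R G) [RHS]big_mkcond /=; apply: eq_bigr => t _.
by rewrite eq_sym; case: eqP => _; rewrite ?mul1mx ?mul0mx.
Qed.

Lemma sum_mul_delta p (G : nat -> 'M[C]_q) (l : nat) :
  \sum_(t < p) G t *m (if l == t :> nat then 1%:M else 0) = if (l < p)%N then G l else 0.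
Proof.
rewrite -(@big_ord1_eq _ 0 +%R G) [RHS]big_mkcond /=; apply: eq_bigr => t _.
by rewrite eq_sym; case: eqP => _; rewrite ?mulmx1 ?mulmx0.
Qed.

Lemma adj_delta (b : bool) :
  (if b then 1%:M else 0 : 'M[C]_q)^H = if b then 1%:M else 0.
Proof. by case: b; rewrite ?adjmx1 ?adjmx0. Qed.

(** This matrix and the next two realize [E], [F] and [e]: they place [m] blocks in the first [m]
    positions, [m] blocks in the last [m] positions, and one block in the last position. *)
Definition inj_blk m : 'M[C]_(m.+1 * q, m * q) :=
  rblockmx m.+1 m (fun l k => if l == k then 1%:M else 0).
Definition shift_blk m : 'M[C]_(m.+1 * q, m * q) :=
  rblockmx m.+1 m (fun l k => if l == k.+1 then 1%:M else 0).
Definition last_blk m : 'M[C]_(m.+1 * q, q) :=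
  bcol m.+1 (fun l => if l == m then 1%:M else 0).

Lemma inj_blkH m :
  (inj_blk m)^H = rblockmx m m.+1 (fun l k => if l == k then 1%:M else 0).
Proof.
by rewrite adj_rblockmx; apply: eq_rblockmx => l k _ _; rewrite adj_delta eq_sym.
Qed.

Lemma inj_blkH_mul m p F :
  (inj_blk m)^H *m rblockmx m.+1 p F = rblockmx m p F.
Proof.
rewrite inj_blkH mul_rblockmx; apply: eq_rblockmx => l k lm _.
by rewrite (sum_delta_mul _ (F ^~ k)) ltnS ltnW.
Qed.

Lemma mul_inj_blk m p F :
  rblockmx p m.+1 F *m inj_blk m = rblockmx p m F.
Proof.
rewrite mul_rblockmx; apply: eq_rblockmx => l k _ km.
under eq_bigr do rewrite eq_sym.
by rewrite sum_mul_delta ltnS ltnW.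
Qed.

Lemma inj_blkH_bcol m F : (inj_blk m)^H *m bcol m.+1 F = bcol m F.
Proof.
rewrite inj_blkH mul_rblockmx_bcol; apply: eq_bcol => l lm.
by rewrite sum_delta_mul ltnS ltnW.
Qed.

Lemma last_blkH_bcol m F : (last_blk m)^H *m bcol m.+1 F = F m.
Proof.
rewrite mul_adj_bcol; under eq_bigr do rewrite adj_delta eq_sym.
by rewrite sum_delta_mul ltnSn.
Qed.

Lemma mul_last_blk m p F :
  rblockmx p m.+1 F *m last_blk m = bcol p (fun l => F l m).
Proof.
rewrite mul_rblockmx_bcol; apply: eq_bcol => l _.
under eq_bigr do rewrite eq_sym.
by rewrite sum_mul_delta ltnSn.
Qed.

Lemma last_blkH_inj m : (last_blk m)^H *m inj_blk m = 0.
Proof.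
apply: (can_inj (@adjmxK _ _ _)); rewrite adjmxM adjmxK adjmx0 inj_blkH_bcol.
by apply/matrixP=> i k; rewrite !mxE ltn_eqF // ent0.
Qed.

Lemma last_blkH_last m : (last_blk m)^H *m last_blk m = 1%:M.
Proof. by rewrite last_blkH_bcol eqxx. Qed.

Lemma inj_blkH_inj m : (inj_blk m)^H *m inj_blk m = 1%:M.
Proof. by rewrite inj_blkH_mul rblockmx1. Qed.

Lemma inj_last_resolution m :
  inj_blk m *m (inj_blk m)^H + last_blk m *m (last_blk m)^H = 1%:M.
Proof.
rewrite inj_blkH mul_rblockmx mul_bcol_adj rblockmxD -rblockmx1.
apply: eq_rblockmx => l k; rewrite !ltnS => lm km.
rewrite (sum_delta_mul _ (fun t => if t == k then 1%:M else 0)) adj_delta.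
case: ltngtP lm => // [lm|->] _; rewrite ?mul0mx ?addr0 //.
by rewrite mul1mx add0r eq_sym.
Qed.

Lemma Tm_shift_inj j : Tm C q j.+1 = shift_blk j.+1 *m (inj_blk j.+1)^H.
Proof.
rewrite /Tm blockmxE inj_blkH mul_rblockmx; apply: eq_rblockmx => l k lj _.
case: l lj => [|l] lj; first by rewrite big1 // => t _; rewrite mul0mx.
under eq_bigr do rewrite eqSS.
rewrite (sum_delta_mul _ (fun t => if t == k then 1%:M else 0)) eqSS.
by rewrite -ltnS lj.
Qed.

Lemma Tm_inj_shift j : Tm C q j = (inj_blk j.+1)^H *m shift_blk j.+1.
Proof. by rewrite inj_blkH_mul. Qed.

(** The matrix is lower triangular with unit diagonal, so the resolvent is a true inverse for every
    [z], never the default value of [invmx]. *)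
Lemma Tm_unit j z : 1%:M - z *: Tm C q j \in unitmx.
Proof.
rewrite unitmxE det_trig.
  rewrite big1 ?unitr1 // => i _; rewrite !mxE eqxx ltn_eqF //.
  by rewrite ent0 mulr0 subr0.
apply/is_trig_mxP => i k ik; rewrite !mxE -val_eqE ltn_eqF //=.
case: eqP => [ikd|_]; last by rewrite ent0 mulr0 subr0.
by have := leq_div2r q (ltnW ik); rewrite ikd ltnn.
Qed.

Lemma inj_blk_entry m i k : inj_blk m i k = (i == k :> nat)%:R.
Proof. by rewrite mxE [in RHS]eqn_blk; case: (_ == _); rewrite ?ent1 ?ent0. Qed.

Lemma last_blk_entry m i k : last_blk m i k = (i == m * q + k :> nat)%:R.
Proof.
rewrite mxE [in RHS]eqn_blk; have q0 : (0 < q)%N by apply: leq_ltn_trans (ltn_ord k).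
rewrite divnMDl // [(k %/ q)%N]divn_small // addn0 modnMDl [(k %% q)%N]modn_small //.
by case: (_ == _); rewrite ?ent1 ?ent0 /=.
Qed.

(** Removes the cast in [hrow]; for [W = - Y^H K'^-1] the right side is the row [h] of the block
    inversion. *)
Lemma hrowE m (W : 'M[C]_(q, m * q)) : hrow W = W *m (inj_blk m)^H + (last_blk m)^H.
Proof.
apply/matrixP => i k; rewrite castmxE cast_ord_id 3!mxE.
rewrite (eq_bigr (fun t => W i t *+ (t == k :> nat))); last first.
  move=> t _; rewrite 2![in LHS]mxE inj_blk_entry eq_sym.
  by case: (_ == _); rewrite ?conjC1 ?conjC0 ?mulr1 ?mulr0.
rewrite 2!mxE last_blk_entry; case: splitP => t /= kt; rewrite kt.
  rewrite (bigD1 t) //= eqxx big1 => [|r rt].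
    rewrite addr0 [_ == _ in RHS]ltn_eqF ?conjC0 ?addr0 //.
    by apply: leq_trans (ltn_ord t) _; rewrite leq_addr.
  by rewrite val_eqE (negPf rt).
rewrite big1 => [|r _].
  rewrite add0r mxE eqn_add2l eq_sym -val_eqE.
  by case: (_ == _); rewrite ?conjC1 ?conjC0.
by rewrite ltn_eqF // (leq_trans (ltn_ord r)) // leq_addr.
Qed.

(** * Block Hankel matrices: Lyapunov equation and growth by one block *)

Section Hankel.
Variables (c : nat -> 'M[C]_q) (w : 'M[C]_q).

Definition hankel m := blockmx m (fun l k => c (l + k)%N).
Definition hcol m := bcol m (fun l => if l == 0%N then w else - c l.-1).
Definition hlast m := bcol m (fun l => c (m + l)%N).

(** Both products shift the Hankel index down by one, so they agree away from the first block row
    and column, where the right side lives. In the corner the right side is [w - w^H], zero because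
    [w] is Hermitian. *)
Lemma hankel_lyapunov j : 
    w^H = w -> (forall i, (i <= j)%N -> (c i)^H = c i) ->
  hankel j.+1 *m (Tm C q j)^H - Tm C q j *m hankel j.+1 =
  hcol j.+1 *m (vv C q j)^H - vv C q j *m (hcol j.+1)^H.
Proof.
move=> wH cH; rewrite /hankel /Tm !blockmxE adj_rblockmx !mul_rblockmx.
rewrite !mul_bcol_adj !rblockmxB.
apply: eq_rblockmx => l k lj kj; rewrite adj_delta.
under eq_bigr do rewrite adj_delta.
case: l k lj kj => [|l] [|k] lj kj /=; rewrite ?mul1mx ?mul0mx ?mulmx1 ?mulmx0 ?wH.
- by rewrite !big1 ?subrr // => t _; rewrite ?mul0mx ?mulmx0.
- under eq_bigr do rewrite eqSS.
  rewrite (sum_mul_delta _ (fun t => c (0 + t)%N)) (ltnW kj) big1; last first.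
    by move=> t _; rewrite mul0mx.
  by rewrite adjmxN cH 1?ltnW // subr0 sub0r opprK.
- under [X in _ - X]eq_bigr do rewrite eqSS.
  rewrite (sum_delta_mul _ (fun t => c (t + 0)%N)) (ltnW lj) big1; last first.
    by move=> t _; rewrite mulmx0.
  by rewrite sub0r subr0 addn0.
under eq_bigr do rewrite eqSS.
under [X in _ - X]eq_bigr do rewrite eqSS.
rewrite (sum_mul_delta _ (fun t => c (l.+1 + t)%N)).
rewrite (sum_delta_mul _ (fun t => c (t + k.+1)%N)).
by rewrite (ltnW lj) (ltnW kj) addnS subrr subr0.
Qed.

Definition hankel_potapov (a z : C) j :=
  potapov _ _ _ (hcol j.+1) (vv C q j)
    ((Rm q j z^* )^H *m (invmx (hankel j.+1) *m Rm q j a)) (z - a).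

(** The instance of [potapov_step] with [h = hrow W]. As [hankel m] has [m] blocks, the new corner
    entry of [hankel j.+2] has index [2 * j.+1]; the minus sign of the Schur complement is inside
    [W]. *)
Lemma hankel_potapov_step a z j :
    let W := - (hlast j.+1)^H *m invmx (hankel j.+1) in
    a^* = a -> w^H = w -> (forall i, (i <= 2 * j.+1)%N -> (c i)^H = c i) ->
    is_posdef (hankel j.+2) ->
  hankel_potapov a z j.+1 = hankel_potapov a z j *m
    potapov _ _ _ (hrow W *m Rm q j.+1 a *m hcol j.+2)
      (hrow W *m Rm q j.+1 a *m vv C q j.+1)
      (invmx (c (2 * j.+1) + W *m hlast j.+1)) (z - a).
Proof.
move=> W aR wH cH posK; set E := inj_blk j.+1; set e := last_blk j.+1.
set K := hankel j.+2.
have KE : E^H *m K *m E = hankel j.+1.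
  by rewrite /K /hankel !blockmxE inj_blkH_mul mul_inj_blk.
have YE : E^H *m K *m e = hlast j.+1.
  rewrite /K /hankel !blockmxE inj_blkH_mul mul_last_blk.
  by apply: eq_bcol => l _; rewrite addnC.
have eKe : e^H *m K *m e = c (2 * j.+1).
  rewrite /K /hankel !blockmxE -mulmxA mul_last_blk last_blkH_bcol.
  by rewrite addnn mul2n.
have KH : K^H = K.
  rewrite /K /hankel !blockmxE adj_rblockmx; apply: eq_rblockmx => l k lj kj.
  by rewrite addnC cH // mul2n -addnn leq_add.
have EE := inj_blkH_inj j.+1.
have uK' : hankel j.+1 \in unitmx.
  by apply: posdef_unitmx; rewrite -KE; apply: (posdef_congr _ _ _ _ _ E^H).
have TE : E^H *m shift_blk j.+1 = Tm C q j by rewrite Tm_inj_shift.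
have := schur_invmx _ _ _ _ K E e KH _ posK (last_blkH_inj _) (last_blkH_last _)
  (inj_last_resolution _).
rewrite KE YE eKe => /(_ uK') [] ; rewrite -!mulNmx -/W -hrowE => Kh invK.
have lyap : K *m (Tm C q j.+1)^H - Tm C q j.+1 *m K =
    hcol j.+2 *m (vv C q j.+1)^H - vv C q j.+1 *m (hcol j.+2)^H.
  apply: hankel_lyapunov => // i ij; apply: cH.
  by rewrite mul2n -addnn (leq_trans ij) // leq_addr.
have := potapov_step _ _ _ _ E (shift_blk j.+1) (Tm C q j.+1) K (hcol j.+2)
  (vv C q j.+1) (hrow W) (c (2 * j.+1) + W *m hlast j.+1) a z aR
  (Tm_shift_inj j) (Tm_unit j.+1).
rewrite TE KE => /(_ (Tm_unit j) uK' invK Kh lyap).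
(* Compression by [E^H] merely truncates the columns, since their blocks do not depend on the
   length. *)
rewrite /hcol /vv !inj_blkH_bcol; exact.
Qed.

(** Dropping the last block is compression by the isometry [inj_blk], repeated [p - m] times. *)
Lemma posdef_hankel m p : (m <= p)%N -> is_posdef (hankel p) -> is_posdef (hankel m).
Proof.
move/subnK <-; elim: (p - m)%N => [|k IHk] // posK; apply: IHk.
have -> : hankel (k + m) =
    (inj_blk (k + m))^H *m hankel (k + m).+1 *m inj_blk (k + m).
  by rewrite /hankel !blockmxE inj_blkH_mul mul_inj_blk.
exact: (posdef_congr _ _ _ _ _ _ (inj_blkH_inj _) posK).
Qed.

(** For one block the shift is zero and both resolvents are trivial; the unitary [V] identifies the
    sizes [1 * q] and [q], and [potapov_mul] moves it into the middle matrix. *)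
Lemma hankel_potapov0 a z : is_posdef (hankel 1) ->
  hankel_potapov a z 0 = potapov _ _ _ w 1%:M (invmx (c 0)) (z - a).
Proof.
move=> posK; set V := vv C q 0.
have VV : V^H *m V = 1%:M.
  by rewrite mul_adj_bcol big_ord1 adjmx1 mulmx1.
have VVH : V *m V^H = 1%:M.
  rewrite mul_bcol_adj -rblockmx1; apply: eq_rblockmx => -[] // [] // _ _.
  by rewrite adjmx1 mulmx1.
have KE : hankel 1 = V *m c 0 *m V^H.
  rewrite mul_bcol mul_bcol_adj; apply: eq_rblockmx => -[] // [] // _ _.
  by rewrite adjmx1 mulmx1 mul1mx.
have uE : hcol 1 = V *m w.
  by rewrite mul_bcol; apply: eq_bcol => -[] // _; rewrite mul1mx.
have T0 : Tm C q 0 = 0.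
  apply/matrixP => i k; rewrite !mxE.
  by have := blk_div _ i; rewrite ltnS leqn0 => /eqP ->; rewrite ent0.
have cE : c 0 = V^H *m hankel 1 *m V.
  by rewrite KE !mulmxA VV mul1mx -mulmxA VV mulmx1.
have uc : c 0 \in unitmx.
  by rewrite cE; apply: posdef_unitmx; apply: (posdef_congr _ _ _ _ _ _ VV posK).
have invK : invmx (hankel 1) = V *m invmx (c 0) *m V^H.
  apply: (can_inj (mulKmx (posdef_unitmx _ _ _ posK))).
  rewrite mulmxV ?posdef_unitmx // KE !mulmxA -(mulmxA _ V^H) VV mulmx1.
  by rewrite mulmxK // VVH.
rewrite /hankel_potapov /Rm T0 !scaler0 subr0 invmx1 adjmx1 mul1mx mulmx1 invK uE.
rewrite -/V -[V in potapov _ _ _ _ V]mulmx1 potapov_mul !mulmxA VV mul1mx.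
by rewrite -mulmxA VV mulmx1.
Qed.

End Hankel.
End Blocks.

(** * Ordered products extended on the right *)

Lemma mxprod_rcons (R : pzRingType) m (l : seq 'M[R]_m) A :
  mxprod (rcons l A) = mxprod l *m A.
Proof.
elim: l => [|B l IHl] /=; first by rewrite mulmx1 mul1mx.
by rewrite IHl mulmxA.
Qed.

Lemma mxprod_iota (R : pzRingType) m (f : nat -> 'M[R]_m) k :
  mxprod [seq f i | i <- iota 0 k.+1] = mxprod [seq f i | i <- iota 0 k] *m f k.
Proof. by rewrite -addn1 iotaD map_cat cats1 mxprod_rcons. Qed.

(** * The odd and even families as Hankel instances *)

Section BlaschkePotapov.
Variables (C : numClosedFieldType) (q : nat) (a b : C) (s : nat -> 'M[C]_q).
Hypotheses (aR : a^* = a) (bR : b^* = b) (s0H : (s 0)^H = s 0).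

Let kseq i : 'M[C]_q := b *: s i - s i.+1.

Lemma ut1E j : ut1 b s j = hcol C q kseq (s 0) j.+1.
Proof. by apply: eq_bcol => -[|l] _ //=; rewrite opprB. Qed.

Lemma UtildeE j z : Utilde a b s j z = hankel_potapov C q kseq (s 0) a z j.
Proof.
by rewrite /hankel_potapov potapovE /Utilde ut1E !mulmxA.
Qed.

Lemma dodd0E z : dodd a b s 0 z = potapov C q q (s 0) 1%:M (invmx (kseq 0)) (z - a).
Proof. by rewrite potapovE. Qed.

Lemma doddSE j z :
  let W := - (hlast C q kseq j.+1)^H *m invmx (hankel C q kseq j.+1) in
  dodd a b s j.+1 z =
    potapov C q q (hrow W *m Rm q j.+1 a *m hcol C q kseq (s 0) j.+2)
      (hrow W *m Rm q j.+1 a *m vv C q j.+1)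
      (invmx (kseq (2 * j.+1) + W *m hlast C q kseq j.+1)) (z - a).
Proof.
by move=> W; rewrite potapovE /dodd /Theta1 /Gam1 ut1E /K1hat -!mulNmx.
Qed.

Lemma Utilde_step j z :
    (forall i, (i <= (2 * j.+1).+1)%N -> (s i)^H = s i) -> is_posdef (K1 b s j.+1) ->
  Utilde a b s j.+1 z = Utilde a b s j z *m dodd a b s j.+1 z.
Proof.
move=> sH posK; rewrite !UtildeE doddSE hankel_potapov_step // => i ij.
by rewrite adjmxB adjmxZ bR !sH // ltnW.
Qed.

Lemma UhatE j z : Uhat a b s j z =
  shear C q (s 0) z *m hankel_potapov C q (shat a b s) (u20 a b s) a z j *m
  shear C q (s 0) (- a).
Proof.
by rewrite shear_potapov /Uhat !mulmxA scalerDr.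
Qed.

(** [Q2] at [a] is minus the sheared column [u + a v s_0]; this sign explains why the signs of the
    diagonal terms are opposite to those of [dodd]. Taking the adjoint of [Q2] uses that [s 0] is
    Hermitian. *)
Lemma dev_conj j z u v kap :
    P2 a b s j a = v -> Q2 a b s j a = - (u + a *: (v *m s 0)) -> H2hat a b s j = kap ->
  dev a b s j z = shear C q (s 0) a *m
    potapov C q q u v (invmx kap) (z - a) *m shear C q (s 0) (- a).
Proof.
move=> PE QE kE; rewrite shear_potapov /dev PE QE kE subrr scale0r add0r.
rewrite adjmxN adjmxD adjmxZ adjmxM aR s0H !mulNmx !mulmxN opprK !scalerN opprK.
by rewrite scaleNr.
Qed.

Lemma dev0E z : dev a b s 0 z = shear C q (s 0) a *m
  potapov C q q (u20 a b s) 1%:M (invmx (shat a b s 0)) (z - a) *m shear C q (s 0) (- a).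
Proof. by apply: dev_conj => //=; rewrite mul1mx. Qed.

Lemma devSE j z :
  let W := - (hlast C q (shat a b s) j.+1)^H *m invmx (hankel C q (shat a b s) j.+1) in
  dev a b s j.+1 z = shear C q (s 0) a *m
    potapov C q q (hrow W *m Rm q j.+1 a *m hcol C q (shat a b s) (u20 a b s) j.+2)
      (hrow W *m Rm q j.+1 a *m vv C q j.+1)
      (invmx (shat a b s (2 * j.+1) + W *m hlast C q (shat a b s) j.+1)) (z - a) *m
    shear C q (s 0) (- a).
Proof.
move=> W; apply: dev_conj => //; last by rewrite /H2hat -!mulNmx.
by rewrite /Q2 mulmxDr -scalemxAr !mulmxA.
Qed.

Lemma shearK x y (A B : 'M[C]_(q + q)) : shear C q (s 0) x *m A *m
    shear C q (s 0) (- y) *m (shear C q (s 0) y *m B) = shear C q (s 0) x *m (A *m B).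
Proof.
rewrite -!mulmxA [shear _ _ _ (- y) *m _]mulmxA -shearD addNr.
by rewrite /shear scale0r -scalar_mx_block mul1mx.
Qed.

Lemma shatH j : (forall i, (i <= j.+2)%N -> (s i)^H = s i) ->
  (shat a b s j)^H = shat a b s j.
Proof.
move=> sH; rewrite /shat adjmxB adjmxD !adjmxZ rmorphN rmorphM rmorphD /= aR bR.
by rewrite !sH ?leqnn ?leqnSn ?(ltnW (leqnSn j.+1)).
Qed.

Lemma u20H : (s 1)^H = s 1 -> (u20 a b s)^H = u20 a b s.
Proof.
by move=> s1H; rewrite /u20 adjmxD adjmxZ rmorphN rmorphD /= aR bR s0H s1H.
Qed.

(** The right shear at [-a] of the smaller matrix cancels the left shear at [a] of the factor,
    leaving the Hankel step. The bound on indices is larger by two because [shat i] involves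
    [s i.+2]. *)
Lemma Uhat_step j z :
    (forall i, (i <= (2 * j.+1).+2)%N -> (s i)^H = s i) -> is_posdef (H2 a b s j.+1) ->
  Uhat a b s j.+1 z = Uhat a b s j z *m dev a b s j.+1 z.
Proof.
move=> sH posH; rewrite !UhatE devSE -(mulmxA (shear _ _ _ a)) shearK !mulmxA.
rewrite hankel_potapov_step ?u20H ?sH ?mulmxA // => i ij.
by apply: shatH => k ki; apply: sH; apply: leq_trans ki _; rewrite !ltnS.
Qed.

(** Splitting [z] as [(z - a) + a] factors the left shear into [d0] and the left shear of the first
    factor. *)
Lemma Uhat0 z : is_posdef (H2 a b s 0) ->
  Uhat a b s 0 z = d0 a s z *m dev a b s 0 z.
Proof.
move=> posH; rewrite UhatE dev0E hankel_potapov0 // !mulmxA.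
by rewrite -[d0 _ _ _]/(shear C q (s 0) (z - a)) -shearD subrK.
Qed.

Lemma Utilde0 z : is_posdef (K1 b s 0) -> Utilde a b s 0 z = dodd a b s 0 z.
Proof. by move=> posK; rewrite UtildeE dodd0E hankel_potapov0. Qed.

End BlaschkePotapov.

(** * Recursions and their telescoped products *)

Theorem mainTheorem3 (C : numClosedFieldType) (q n : nat) (a b : C)
    (s : nat -> 'M[C]_q) :
  (0 < q)%N -> (0 < n)%N ->
  a \is Num.real -> b \is Num.real -> a < b ->
  (forall j, (j <= 2 * n + 1)%N -> is_hermitian (s j)) ->
  is_posdef (H2 a b s n.-1) -> is_posdef (K1 b s n) ->
  forall z : C,
    (Uhat a b s 0 z = d0 a s z *m dev a b s 0 z) /\
        (Utilde a b s 0 z = dodd a b s 0 z) /\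
        (forall j, (1 <= j <= n - 1)%N ->
           Uhat a b s j z = Uhat a b s j.-1 z *m dev a b s j z) /\
        (forall j, (1 <= j <= n)%N ->
           Utilde a b s j z = Utilde a b s j.-1 z *m dodd a b s j z) /\
        (forall j, (j <= n - 1)%N ->
           Uhat a b s j z = mxprod [seq deven a b s i z | i <- iota 0 j.+2]) /\
      (forall j, (j <= n)%N ->
           Utilde a b s j z = mxprod [seq dodd a b s i z | i <- iota 0 j.+1]).
Proof.
move=> _ n_gt0 aR bR _ sH posH posK z.
have {}aR : a^* = a by apply/CrealP.
have {}bR : b^* = b by apply/CrealP.
have {}sH j : (j <= (2 * n).+1)%N -> (s j)^H = s j by rewrite -addn1; apply: sH.
have s0H := sH 0%N isT.
have posHj j : (j <= n - 1)%N -> is_posdef (H2 a b s j).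
  by rewrite subn1 => jn; apply: (posdef_hankel _ _ (shat a b s) j.+1 n.-1.+1).
have posKj j : (j <= n)%N -> is_posdef (K1 b s j).
  by move=> jn; apply: (posdef_hankel _ _ (fun i => b *: s i - s i.+1) j.+1 n.+1).
have U0 : Uhat a b s 0 z = d0 a s z *m dev a b s 0 z by apply: Uhat0 => //; apply: posHj.
have V0 : Utilde a b s 0 z = dodd a b s 0 z by apply: Utilde0; apply: posKj.
have US j : (1 <= j <= n - 1)%N -> Uhat a b s j z = Uhat a b s j.-1 z *m dev a b s j z.
  case: j => // j jn; apply: Uhat_step => // [i ij|]; last exact: posHj.
  (* The step reads [s] up to index [2 * j.+1 + 2 = 2 * j.+2], which must stay within [2 * n]. *)
  have jn2 : (j.+2 <= n)%N by rewrite -[n]prednK // ltnS -subn1.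
  by apply/sH/(leq_trans ij)/leqW; rewrite -[_.+2]add2n -mulnS leq_mul2l.
have VS j : (1 <= j <= n)%N -> Utilde a b s j z = Utilde a b s j.-1 z *m dodd a b s j z.
  case: j => // j jn; apply: Utilde_step => // [i ij|]; last exact: posKj.
  by apply/sH/(leq_trans ij); rewrite ltnS leq_mul2l.
split=> //; split=> //; split=> //; split=> //; split.
  (* The even product has [j.+2] factors, because [deven] starts with [d0] and reaches [dev j] only
     at index [j.+1]. *)
  elim=> [|j IHj] jn; first by rewrite U0 /= mulmx1.
  by rewrite US // mxprod_iota -IHj // ltnW.
elim=> [|j IHj] jn; first by rewrite V0 /= mulmx1.
by rewrite VS // mxprod_iota -IHj // ltnW.
Qed.
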